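(* Let $G$ be a hypergraph with vertex set $\{1,\dots,n\}$ and let $f:\{0,1\}^n\to\{0,1\}$ be the Boolean function determining the hypergraph state $|G\rangle$. Then for every $i\in[2^n]$, $$f(\mathrm{bin}(i))=|E_i| \bmod 2,$$ where $E_i=\{e\in E(G): e\subseteq\mathcal O(i)\}$.
   Context: $[2^n]=\{0,1,\dots,2^n-1\}$, and $\mathrm{bin}(i)=(i_1,\dots,i_n)\in\{0,1\}^n$ is the $n$-term binary representation of $i$ (most significant digit first). $\mathcal O(i)=\{v\in\{1,\dots,n\}: i_v=1\}$. $|0\rangle,|1\rangle$ is the standard basis of $\mathcal H_2=\mathbb C^2$, and $|\mathrm{bin}(i)\rangle=|i_1\rangle\otimes\cdots\otimes|i_n\rangle$. A hypergraph $G=(V(G),E(G))$ has vertex set $V(G)=\{1,\dots,n\}$ and a set $E(G)$ of hyperedges, each a subset of $V(G)$. For $e\subseteq V(G)$, $Z_e$ is the linear operator on $\mathcal H_2^{\otimes n}$ with $Z_e|\mathrm{bin}(i)\rangle=-|\mathrm{bin}(i)\rangle$ if $i_v=1$ for all $v\in e$, and $Z_e|\mathrm{bin}(i)\rangle=|\mathrm{bin}(i)\rangle$ otherwise. With $|+\rangle=\frac1{\sqrt2}(|0\rangle+|1\rangle)$, the hypergraph state is $|G\rangle=\left(\prod_{e\in E(G)}Z_e\right)|+\rangle^{\otimes n}$. The Boolean function determining $|G\rangle$ is the unique $f:\{0,1\}^n\to\{0,1\}$ with $|G\rangle=\frac1{\sqrt{2^n}}\sum_{i\in[2^n]}(-1)^{f(\mathrm{bin}(i))}|\mathrm{bin}(i)\rangle$.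 *)

(* Defs.v *)
From HB Require Import structures.
From mathcomp Require Import all_boot all_order all_algebra.
From mathcomp Require Import reals complex mxtens.

Set Implicit Arguments.
Unset Strict Implicit.
Unset Printing Implicit Defensive.

Import Order.TTheory GRing.Theory Num.Theory.
Local Open Scope ring_scope.

(* The vertex v of {1, ..., n} is the ordinal of value v - 1 in 'I_n. *)
Record hypergraph (n : nat) := Hypergraph { edges : {set {set 'I_n}} }.

(* Most significant digit first. *)
Definition bin (n : nat) (i : 'I_(2 ^ n)) : n.-tuple bool :=
  [tuple odd (i %/ 2 ^ (n - v.+1)) | v < n].

Definition ones (n : nat) (i : 'I_(2 ^ n)) : {set 'I_n} :=
  [set v | tnth (bin i) v].

Section States.

Variable R : realType.
Local Notation C := R[i].

(* The pure tensor v_1 (x) ... (x) v_n. The n-fold tensor power of C^2 is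
   realised as C^(2^n) by means of the Kronecker product. *)
Fixpoint tensv (n : nat) : ('I_n -> 'cV[C]_2) -> 'cV[C]_(2 ^ n) :=
  match n return ('I_n -> 'cV[C]_2) -> 'cV[C]_(2 ^ n) with
  | 0 => fun=> 1%:M
  | n'.+1 => fun v => castmx (esym (expnS 2 n'), erefl 1%N)
                        (v ord0 *t tensv (fun k => v (lift ord0 k)))
  end.

Definition ket (b : bool) : 'cV[C]_2 := delta_mx (inord b) 0.

Definition ket_plus : 'cV[C]_2 := (sqrtC 2)^-1 *: (ket false + ket true).

Definition ket_bits (n : nat) (x : n.-tuple bool) : 'cV[C]_(2 ^ n) :=
  tensv (fun v => ket (tnth x v)).

(* Operators are matrices acting on column vectors. This one is given by its
   spectral decomposition in the basis |bin(i)>; [Zop_ket] below is its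
   defining property. The basis vectors have real entries, so that the
   transpose of |bin(i)> is <bin(i)|. *)
Definition Zop (n : nat) (e : {set 'I_n}) : 'M[C]_(2 ^ n) :=
  \sum_(i < 2 ^ n)
    (if [forall v in e, tnth (bin i) v] then -1 else 1)
      *: (ket_bits (bin i) *m (ket_bits (bin i))^T).

(* The operators Zop e commute ([Zop_comm] below), so the order of the
   factors is irrelevant. *)
Definition hypergraph_state (n : nat) (G : hypergraph n) : 'cV[C]_(2 ^ n) :=
  (\prod_(e in edges G) Zop e) *m tensv (fun _ : 'I_n => ket_plus).

Definition determines (n : nat) (f : n.-tuple bool -> bool)
    (G : hypergraph n) : Prop :=
  hypergraph_state G =
    (sqrtC (2 ^ n)%:R)^-1
      *: \sum_(i < 2 ^ n) (-1) ^+ f (bin i) *: ket_bits (bin i).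

End States.

Section Facts.

Variable R : realType.
Local Notation C := R[i].

Lemma tensvE n (w : 'I_n -> 'cV[C]_2) (i : 'I_(2 ^ n)) :
  tensv w i 0 = \prod_v w v (inord (tnth (bin i) v)) 0.
Proof.
elim: n w i => [|n IHn] w i /=.
  by rewrite big_ord0 mxE (ord1 i) eqxx.
rewrite castmxE mxE big_ord_recl.
rewrite [(_ (cast_ord _ 0)).1]ord1 [(_ (cast_ord _ 0)).2]ord1 IHn.
set k := cast_ord _ i; have Ek : k = i :> nat by [].
congr (_ * _).
  congr (w _ _ _); apply/val_inj; rewrite tnth_mktuple subn1 /= -Ek.
  have := ltn_ord (mxtens_unindex k).1; rewrite /=.
  by case: (k %/ _)%N => [|[]] //= _; rewrite inordK.
apply: eq_bigr => v _; congr (w _ (inord _) _).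
rewrite !tnth_mktuple /= /bump /= add1n subSS.
rewrite [in RHS](divn_eq i (2 ^ n)).
have E : (2 ^ n = 2 ^ v.+1 * 2 ^ (n - v.+1))%N by rewrite -expnD subnKC.
rewrite [X in (_ * X + _)%N]E mulnA divnMDl ?expn_gt0 // oddD oddM oddX andbF.
by [].
Qed.

Lemma bin_val n (i : 'I_(2 ^ n)) :
  i = (\sum_(v < n) tnth (bin i) v * 2 ^ (n - v.+1))%N :> nat.
Proof.
rewrite (eq_bigr (fun v : 'I_n =>
   odd (i %/ 2 ^ (n - v.+1)) * 2 ^ (n - v.+1))%N); last first.
  by move=> v _; rewrite tnth_mktuple.
rewrite (reindex_inj rev_ord_inj) /=.
rewrite (eq_bigr (fun v : 'I_n => odd (i %/ 2 ^ v) * 2 ^ v)%N); last first.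
  by move=> v _; rewrite subnSK // subKn // ltnW.
case: i => i /= lti.
elim: n i lti => [|n IHn] i lti; first by rewrite big_ord0; case: i lti.
rewrite big_ord_recl expn0 divn1 muln1 -[LHS]odd_double_half.
congr (_ + _)%N; rewrite {1}[i./2]IHn ?ltn_half_double -?mul2n -?expnS //.
rewrite big_distrr /=; apply: eq_bigr => v _.
by rewrite /bump /= add1n expnS divnMA divn2 mulnCA.
Qed.

Lemma bin_inj n : injective (@bin n).
Proof. by move=> i j E; apply/val_inj; rewrite /= bin_val E -bin_val. Qed.

Lemma ket_binE n (i : 'I_(2 ^ n)) : ket_bits R (bin i) = delta_mx i 0.
Proof.
apply/matrixP=> j k; rewrite (ord1 k) {k} tensvE mxE eqxx andbT.
have ketE (a b : bool) : ket R a (inord b) 0 = (b == a)%:R.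
  by rewrite mxE eqxx andbT -val_eqE /= !inordK; case: a b => -[].
under eq_bigr do rewrite ketE.
have [->|/eqP ji] := eqVneq j i; first by rewrite big1 // => v _; rewrite eqxx.
have /existsP[v nv] : [exists v, tnth (bin j) v != tnth (bin i) v].
  rewrite -negb_forall; apply/negP => /forallP h; apply: ji.
  by apply/bin_inj/eq_from_tnth => v; apply/eqP.
by rewrite (bigD1 v) //= (negPf nv) mul0r.
Qed.

Lemma Zop_diag n (e : {set 'I_n}) :
  Zop R e = diag_mx
    (\row_i (if [forall v in e, tnth (bin i) v] then -1 else 1)).
Proof.
apply/matrixP=> j k; rewrite summxE mxE mxE.
rewrite (bigD1 j) //= big1 ?addr0 => [|i /negPf ij].
  by rewrite mxE ket_binE trmx_delta mul_delta_mx mxE eqxx /= mulr_natr eq_sym.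
by rewrite mxE ket_binE trmx_delta mul_delta_mx mxE eq_sym ij mulr0.
Qed.

Lemma Zop_ket n (e : {set 'I_n}) (i : 'I_(2 ^ n)) :
  Zop R e *m ket_bits R (bin i) =
    if [forall v in e, tnth (bin i) v] then - ket_bits R (bin i)
    else ket_bits R (bin i).
Proof.
rewrite Zop_diag ket_binE; apply/matrixP => j k; rewrite mul_diag_mx !mxE.
have [->|/negPf ji] := eqVneq j i; last first.
  by rewrite mulr0; case: ifP; rewrite !mxE ji ?oppr0.
by case: ifP => _; rewrite !mxE eqxx ?mulN1r ?mul1r.
Qed.

Lemma Zop_comm n (e e' : {set 'I_n}) :
  Zop R e *m Zop R e' = Zop R e' *m Zop R e.
Proof. by rewrite !Zop_diag diag_mxC. Qed.

(* By the next two lemmas, [determines R f G] says that f is the Boolean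
   function of |G>. *)
Lemma determines_uniq n (G : hypergraph n) f g :
  determines R f G -> determines R g G -> f =1 g.
Proof.
move=> Hf; rewrite /determines Hf => E.
suff fg i : f (bin i) = g (bin i).
  have [|h _ hK x] := inj_card_bij (@bin_inj n); last by rewrite -(hK x).
  by rewrite card_tuple card_bool card_ord.
have s0 : (sqrtC (2 ^ n)%:R)^-1 != 0 :> C.
  by rewrite invr_eq0 sqrtC_eq0 pnatr_eq0 expn_eq0.
have coef (h : n.-tuple bool -> bool) :
    (\sum_j (-1) ^+ h (bin j) *: ket_bits R (bin j)) i 0 = (-1) ^+ h (bin i).
  rewrite summxE (bigD1 i) //= big1 => [|j ji].
    by rewrite mxE ket_binE mxE !eqxx mulr1 addr0.
  by rewrite mxE ket_binE mxE eq_sym (negPf ji) mulr0.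
have /(scalerI s0)/matrixP/(_ i 0) := E; rewrite !coef.
by move/signr_inj.
Qed.

Lemma determines_exists n (G : hypergraph n) : exists f, determines R f G.
Proof.
rewrite /determines /hypergraph_state -big_filter.
elim: [seq _ <- _ | _] => [|e s [f IHs]].
  exists xpred0; rewrite big_nil mul1mx; apply/matrixP=> i k.
  rewrite (ord1 k) tensvE mxE summxE [in RHS](bigD1 i) //=.
  rewrite [X in _ * (_ + X)]big1 ?addr0 => [|j /negPf ji]; last first.
    by rewrite mxE ket_binE mxE eq_sym ji mulr0.
  rewrite mxE ket_binE mxE !eqxx !mulr1.
  rewrite (eq_bigr (fun=> (sqrtC 2)^-1)) => [|v _].
    by rewrite prodr_const card_ord natrX exprVn rootCX ?ler0n.
  rewrite !mxE eqxx !andbT -!val_eqE /= !inordK //; last by case: (tnth _ _).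
  by case: (tnth _ _); rewrite /= ?addr0 ?add0r mulr1.
exists (fun x => f x (+) [forall v in e, tnth x v]).
rewrite big_cons -mulmxA IHs -scalemxAr; congr (_ *: _).
rewrite mulmx_sumr; apply: eq_bigr => i _; rewrite -scalemxAr Zop_ket.
by rewrite signr_addb; case: ifP => _; rewrite ?scalerN ?mulr1 ?mulrN1 ?scaleNr.
Qed.

End Facts.

(* Main.v *)
(** Each basis vector |bin(i)> is an eigenvector of every [Zop e], with
    eigenvalue -1 exactly when e is contained in O(i). The product over E(G)
    therefore multiplies |bin(i)> by (-1)^|E_i|, while |+>^n is the uniform
    superposition, so i |-> |E_i| mod 2 determines |G>; conclude by uniqueness
    of the determining function. *)
Require Import Defs.
From HB Require Import structures.
From mathcomp Require Import all_boot all_order all_algebra.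
From mathcomp Require Import reals complex.

Set Implicit Arguments.
Unset Strict Implicit.
Unset Printing Implicit Defensive.

Import GRing.Theory Num.Theory.

Lemma subset_ones n (e : {set 'I_n}) (i : 'I_(2 ^ n)) :
  (e \subset ones i) = [forall v in e, tnth (bin i) v].
Proof.
apply/subsetP/forall_inP => h v ve; first by have := h v ve; rewrite inE.
by rewrite inE h.
Qed.

Local Open Scope ring_scope.

(** Entry by entry: on the right only the term [j = i] survives, and on the left each of the n
    factors is [(sqrtC 2)^-1], whatever the bit. *)
Lemma tensv_plus (R : realType) n :
  tensv (fun _ : 'I_n => ket_plus R) =
    (sqrtC (2 ^ n)%:R)^-1 *: \sum_(i < 2 ^ n) ket_bits R (bin i).
Proof.
apply/matrixP => i k; rewrite (ord1 k) tensvE mxE summxE.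
rewrite [in RHS](bigD1 i) //=.
rewrite [X in _ * (_ + X)]big1 => [|j /negPf ji]; last first.
  by rewrite ket_binE mxE eq_sym ji.
rewrite ket_binE mxE !eqxx addr0 mulr1.
rewrite (eq_bigr (fun=> (sqrtC 2)^-1)) => [|v _].
  by rewrite prodr_const card_ord natrX exprVn rootCX ?ler0n.
rewrite !mxE eqxx !andbT -!val_eqE /= !inordK //; last by case: (tnth _ _).
by case: (tnth _ _); rewrite /= ?addr0 ?add0r mulr1.
Qed.

(** Each factor acts on the basis vector by a sign, so the signs accumulate; a list in place of the
    set [edges G] permits induction. *)
Lemma prod_Zop_ket (R : realType) n (s : seq {set 'I_n}) (i : 'I_(2 ^ n)) :
  (\prod_(e <- s) Zop R e) *m ket_bits R (bin i) =
    (-1) ^+ count (fun e : {set 'I_n} => e \subset ones i) s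
      *: ket_bits R (bin i).
Proof.
elim: s => [|e s IHs]; first by rewrite big_nil mul1mx scale1r.
rewrite big_cons -mulmxA IHs -scalemxAr Zop_ket -subset_ones /= exprD.
by case: ifP => _; rewrite ?mul1r // expr1 mulN1r scalerN scaleNr.
Qed.

Lemma hypergraph_stateE (R : realType) n (G : hypergraph n) :
  hypergraph_state R G =
    (sqrtC (2 ^ n)%:R)^-1 *: \sum_(i < 2 ^ n)
      (-1) ^+ #|[set e in edges G | e \subset ones i]| *: ket_bits R (bin i).
Proof.
rewrite /hypergraph_state tensv_plus -scalemxAr mulmx_sumr.
congr (_ *: _); apply: eq_bigr => i _.
(* The count along the list of edges becomes the cardinality of E_i. *)
rewrite -big_filter prod_Zop_ket -sum1_count big_filter_cond -sum1_card.
by congr (_ ^+ _ *: _); apply: eq_bigl => e; rewrite inE.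
Qed.

Local Close Scope ring_scope.

Theorem theorem1 (R : realType) (n : nat) (G : hypergraph n)
    (f : n.-tuple bool -> bool) (f_det : determines R f G) (i : 'I_(2 ^ n)) :
  f (bin i) = #|[set e in edges G | e \subset ones i]| %% 2 :> nat.
Proof.
(* A determining function takes a bit tuple while [ones] takes an index, so containment in O(i) is
   phrased through bits. *)
pose g (x : n.-tuple bool) :=
  odd #|[set e in edges G | [forall v in e, tnth x v]]|.
have gE j : g (bin j) = odd #|[set e in edges G | e \subset ones j]|.
  by congr odd; apply: eq_card => e; rewrite !inE subset_ones.
have g_det : determines R g G.
  rewrite /determines hypergraph_stateE; congr (_ *: _)%R.
  by apply: eq_bigr => j _; rewrite gE signr_odd.
by rewrite (determines_uniq f_det g_det) gE modn2.
Qed.
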